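(* Let $n=3$, let $\mathsf{L}\colon \mathsf{K}^2\times[0,1]^2\to\mathsf{K}$, and assume that $\prec$ is compatible with $\oplus$. The following monotonicity condition holds: for all $\mathbf{X},\mathbf{Z}\in\mathsf{K}^3$ with $\mathbf{X}\preceq_{(3)}\mathbf{Z}$, $\mathcal{C}_{\preceq,\sigma,\mathsf{L}}(\mathbf{X},\mu)\preceq\mathcal{C}_{\preceq,\tau,\mathsf{L}}(\mathbf{Z},\mu)$ for any $\sigma\in\Pi_{\mathbf{X}}$, $\tau\in\Pi_{\mathbf{Z}}$ and $\mu\in\mathbf{M}$, if and only if all of the following are satisfied: (a) the $\mathcal{C}_{\preceq}$-operator (with $n=3$) is well defined; (b) for any $\mathbf{v}\in\mathsf{K}$ and $b_1,b_2\in[0,1]$ with $b_2\le b_1$, the function $[\mathbf{0},\mathbf{v}]_{\mathsf{K}}\ni\mathbf{x}\mapsto \mathsf{L}(\mathbf{x},\mathbf{0},1,b_1)\oplus \mathsf{L}(\mathbf{v},\mathbf{x},b_1,b_2)$ is non-decreasing w.r.t. $\preceq$; (c) for any $\mathbf{u},\mathbf{v}\in\mathsf{K}$ with $\mathbf{u}\preceq\mathbf{v}$ and $b_1,b_2\in[0,1]$ with $b_2\le b_1$, the function $[\mathbf{u},\mathbf{v}]_{\mathsf{K}}\ni\mathbf{x}\mapsto \mathsf{L}(\mathbf{x},\mathbf{u},b_1,b_2)\oplus \mathsf{L}(\mathbf{v},\mathbf{x},b_2,0)$ is non-decreasing w.r.t. $\preceq$; (d) for any $\mathbf{u}\in\mathsf{K}$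 and $b\in[0,1]$, the function $[\mathbf{u},\mathbf{1}]_{\mathsf{K}}\ni\mathbf{x}\mapsto \mathsf{L}(\mathbf{x},\mathbf{u},b,0)$ is non-decreasing w.r.t. $\preceq$.
   Context: Setting: $\mathsf{U}$ is a non-empty set with a partial order $\preceq_{\mathrm{p}}$ and a commutative associative binary operation $\oplus\colon\mathsf{U}\times\mathsf{U}\to\mathsf{U}$ (called addition). A total order $\preceq$ on $\mathsf{U}$ is an admissible order w.r.t. $\preceq_{\mathrm{p}}$ if $\mathbf{x}\preceq_{\mathrm{p}}\mathbf{z}$ implies $\mathbf{x}\preceq\mathbf{z}$; $\preceq$ is such an order, and $\mathbf{x}\prec\mathbf{z}$ means $\mathbf{x}\preceq\mathbf{z}$ and $\mathbf{x}\ne\mathbf{z}$. $\mathsf{K}\subseteq\mathsf{U}$ is a non-empty set having a least element $\mathbf{0}$ and a greatest element $\mathbf{1}$ w.r.t. $\preceq_{\mathrm{p}}$ (both in $\mathsf{K}$), with $\mathbf{0}\preceq_{\mathrm{p}}\mathbf{1}$ and $\mathbf{0}\ne\mathbf{1}$. $\prec$ is compatible with $\oplus$ if $\mathbf{x}_1\prec\mathbf{x}_2$ implies $\mathbf{x}_1\oplus\mathbf{v}\prec\mathbf{x}_2\oplus\mathbf{v}$ for all $\mathbf{x}_1,\mathbf{x}_2,\mathbf{v}\in\mathsf{U}$. $[n]=\{1,\dots,n\}$. $\mathbf{M}$ is the set of capacities on $[n]$: $\mu\colon 2^{[n]}\to[0,1]$ with $\mu(C)\le\mu(D)$ for $C\subset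 D$, $\mu(\varnothing)=0$, $\mu([n])=1$. For $\mathbf{X},\mathbf{Z}\in\mathsf{U}^n$, $\mathbf{X}\preceq_{(n)}\mathbf{Z}$ means $\mathbf{x}_i\preceq\mathbf{z}_i$ for all $i\in[n]$. For $\mathbf{X}=(\mathbf{x}_1,\dots,\mathbf{x}_n)\in\mathsf{K}^n$, $\Pi_{\mathbf{X}}$ is the set of permutations $\sigma$ of $[n]$ with $\mathbf{x}_{\sigma(1)}\preceq\dots\preceq\mathbf{x}_{\sigma(n)}$. The $\mathcal{C}_{\preceq}$-operator is $\mathcal{C}_{\preceq,\sigma,\mathsf{L}}(\mathbf{X},\mu)=\bigoplus_{i=1}^n \mathsf{L}(\mathbf{x}_{\sigma(i)},\mathbf{x}_{\sigma(i-1)},\mu(B_{\sigma(i)}),\mu(B_{\sigma(i+1)}))$ for $\sigma\in\Pi_{\mathbf{X}}$, with $\mathbf{x}_{\sigma(0)}=\mathbf{0}$, $B_{\sigma(i)}=\{\sigma(i),\dots,\sigma(n)\}$ for $i\in[n]$, $B_{\sigma(n+1)}=\varnothing$. It is well defined if, for every $\mathbf{X}\in\mathsf{K}^n$ and $\mu\in\mathbf{M}$, the value is the same for all $\sigma\in\Pi_{\mathbf{X}}$. For $\mathbf{u},\mathbf{v}\in\mathsf{U}$, $[\mathbf{u},\mathbf{v}]_{\mathsf{K}}=\{\mathbf{x}\in\mathsf{K}:\mathbf{u}\preceq\mathbf{x}\preceq\mathbf{v}\}$. A function $\mathsf{H}\colon\mathsf{K}_0\to\mathsf{U}$ with $\mathsf{K}_0\subseteq\mathsf{K}$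 is non-decreasing w.r.t. $\preceq$ if $\mathbf{x}_1\preceq\mathbf{x}_2$ implies $\mathsf{H}(\mathbf{x}_1)\preceq\mathsf{H}(\mathbf{x}_2)$. *)

(* Defs.v *)
From HB Require Import structures.
From mathcomp Require Import all_boot all_order all_algebra all_fingroup.
From mathcomp Require Import classical_sets reals.

Set Implicit Arguments.
Unset Strict Implicit.
Unset Printing Implicit Defensive.

Import Order.TTheory GRing.Theory Num.Theory.
Local Open Scope ring_scope.

Section AdmissibleOrder.
Context {d : Order.disp_t} {U : porderType d}.
Implicit Types (le : rel U) (K : set U).

Definition admissible le : Prop :=
  [/\ reflexive le, antisymmetric le, transitive le, total le &
      forall x z : U, (x <= z)%O -> le x z].

Definition sprec le : rel U := fun x z => le x z && (x != z).

Definition compatible le (add : U -> U -> U) : Prop :=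
  forall x1 x2 v : U, sprec le x1 x2 -> sprec le (add x1 v) (add x2 v).

Definition is_least K (x : U) : Prop := K x /\ forall y, K y -> (x <= y)%O.

Definition is_greatest K (x : U) : Prop := K x /\ forall y, K y -> (y <= x)%O.

Definition itvK K le (u v : U) : set U :=
  [set x : U | [/\ K x, le u x & le x v]]%classic.

Definition nondecreasing_in le (K0 : set U) (H : U -> U) : Prop :=
  {in K0 &, {homo H : x1 x2 / le x1 x2}}.

End AdmissibleOrder.

Definition capacity (R : realType) (n : nat) (mu : {set 'I_n} -> R) : Prop :=
  [/\ forall C, 0 <= mu C <= 1,
      forall C D : {set 'I_n}, C \subset D -> mu C <= mu D,
      mu finset.set0 = 0 & mu [set: 'I_n]%SET = 1].

(* The index set {1, ..., n} is rendered as the 0-based type 'I_n, so that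
   position i of the text is position i.-1 here.  The operator is defined on
   tuples of length n.+1, so that its sum is never empty: n = 2 gives triples. *)

Section COperator.
Context {R : realType} {d : Order.disp_t} {U : porderType d}.

(* An addition with no neutral element only has non-empty sums; seeding the
   big operator with the last term gives F 0 + (F 1 + (... + F n)). *)
Definition bigadd (V : Type) (add : V -> V -> V) (n : nat) (F : 'I_n.+1 -> V) :
    V :=
  \big[add/F ord_max]_(i < n) F (lift ord_max i).

Definition sorting (le : rel U) (n : nat) (X : 'I_n -> U) (sigma : 'S_n) :
    Prop :=
  sorted le [seq X (sigma i) | i <- enum 'I_n].

(* {sigma(i), ..., sigma(n-1)}; it is empty for i = n. *)
Definition upper (n : nat) (sigma : 'S_n) (i : nat) : {set 'I_n} :=
  [set sigma j | j in 'I_n & (i <= j)%N]%SET.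

Definition previous (zero : U) (n : nat) (X : 'I_n.+1 -> U)
    (sigma : 'S_n.+1) (i : nat) : U :=
  if i is j.+1 then X (sigma (inord j)) else zero.

(* L stands for a map K^2 x [0,1]^2 -> K: it is only evaluated there when X is
   K-valued and mu is a capacity. *)
Definition Cop (add : U -> U -> U) (zero : U) (L : U -> U -> R -> R -> U)
    (n : nat) (sigma : 'S_n.+1) (X : 'I_n.+1 -> U)
    (mu : {set 'I_n.+1} -> R) : U :=
  bigadd add (fun i : 'I_n.+1 =>
    L (X (sigma i)) (previous zero X sigma i)
      (mu (upper sigma i)) (mu (upper sigma i.+1))).

Definition Cop_well_defined (add : U -> U -> U) (le : rel U) (K : set U)
    (zero : U) (L : U -> U -> R -> R -> U) (n : nat) : Prop :=
  forall (X : 'I_n.+1 -> U) (mu : {set 'I_n.+1} -> R),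
    (forall i, K (X i)) -> capacity mu ->
    forall sigma tau : 'S_n.+1, sorting le X sigma -> sorting le X tau ->
      Cop add zero L sigma X mu = Cop add zero L tau X mu.

Definition Cop_monotone (add : U -> U -> U) (le : rel U) (K : set U)
    (zero : U) (L : U -> U -> R -> R -> U) (n : nat) : Prop :=
  forall X Z : 'I_n.+1 -> U,
    (forall i, K (X i)) -> (forall i, K (Z i)) ->
    (forall i, le (X i) (Z i)) ->
    forall (sigma tau : 'S_n.+1) (mu : {set 'I_n.+1} -> R),
      sorting le X sigma -> sorting le Z tau -> capacity mu ->
      le (Cop add zero L sigma X mu) (Cop add zero L tau Z mu).

End COperator.

(* Main.v *)
(* Sufficiency.  A pair X <= Z sorted by a common permutation is handled by
   raising the largest entry, then the middle one, then the smallest, using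
   (d), (c) and (b) in turn.  An arbitrary pair is joined by the truncations
   min(Z, max(X, c)), where c runs through the entries of X and Z in increasing
   order: between two consecutive thresholds the entries that move all go from
   one threshold to the next while no other entry lies strictly in between, so
   consecutive truncations have a common sorting permutation, and by
   well-definedness the choice of permutation is irrelevant.
   Necessity.  Apply monotonicity to (x, v, v), (u, x, v) and (u, u, x), with a
   capacity of prescribed values on the sets {2, 3} and {3}, and cancel the
   common terms, which is possible since the strict order is compatible with
   the addition. *)
Require Import Defs.
From HB Require Import structures.
From mathcomp Require Import all_boot all_order all_algebra all_fingroup.
From mathcomp Require Import classical_sets reals.

Set Implicit Arguments.
Unset Strict Implicit.
Unset Printing Implicit Defensive.

Import Order.TTheory GRing.Theory Num.Theory.
Local Open Scope ring_scope.

(** * Sortings, upper sets and capacities for three criteria *)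

Section Triples.
Context {R : realType} {d : Order.disp_t} {U : porderType d}.

Lemma ord3P (P : 'I_3 -> Prop) :
  P (inord 0) -> P (inord 1) -> P (inord 2) -> forall i, P i.
Proof.
move=> P0 P1 P2 i; rewrite -(inord_val i).
by case: i => -[|[|[|m]]].
Qed.

Lemma sorting3 (le : rel U) (X : 'I_3 -> U) (sigma : 'S_3) :
  sorting le X sigma <->
  le (X (sigma (inord 0))) (X (sigma (inord 1))) /\
  le (X (sigma (inord 1))) (X (sigma (inord 2))).
Proof.
have e : enum 'I_3 = [:: inord 0; inord 1; inord 2].
  by apply: (inj_map val_inj); rewrite val_enum_ord /= !inordK.
by rewrite /sorting e /= andbT; split => /andP.
Qed.

Lemma upper0 (n : nat) (sigma : 'S_n) : upper sigma 0 = [set: 'I_n]%SET.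
Proof.
apply/setP => i; rewrite inE; apply/imsetP.
by exists ((sigma^-1)%g i); rewrite ?inE // permKV.
Qed.

Lemma upper_full (n : nat) (sigma : 'S_n) : upper sigma n = finset.set0.
Proof.
apply/setP => i; rewrite inE; apply/negbTE/imsetP => -[j].
by rewrite inE leqNgt ltn_ord.
Qed.

Lemma upperS (n : nat) (sigma : 'S_n) (i j : nat) :
  (i <= j)%N -> upper sigma j \subset upper sigma i.
Proof.
move=> ij; apply/fintype.subsetP => k /imsetP[l]; rewrite inE => jl ->.
by apply/imsetP; exists l => //; rewrite inE (leq_trans ij).
Qed.

Lemma Cop3 (add : U -> U -> U) (zero : U) (L : U -> U -> R -> R -> U)
    (sigma : 'S_3) (X : 'I_3 -> U) (mu : {set 'I_3} -> R) :
  capacity mu ->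
  Cop add zero L sigma X mu =
  add (L (X (sigma (inord 0))) zero 1 (mu (upper sigma 1)))
    (add (L (X (sigma (inord 1))) (X (sigma (inord 0)))
            (mu (upper sigma 1)) (mu (upper sigma 2)))
         (L (X (sigma (inord 2))) (X (sigma (inord 1)))
            (mu (upper sigma 2)) 0)).
Proof.
case=> _ _ mu0 mu1; rewrite /Cop /bigadd !big_ord_recl big_ord0 /=.
rewrite upper0 upper_full mu0 mu1.
have -> : lift ord_max (ord0 : 'I_2) = inord 0.
  by apply: val_inj; rewrite /= inordK.
have -> : lift ord_max (lift ord0 (ord0 : 'I_1)) = inord 1 :> 'I_3.
  by apply: val_inj; rewrite /= inordK.
have -> : ord_max = inord 2 :> 'I_3 by apply: val_inj; rewrite /= inordK.
by [].
Qed.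

Definition triple (x y z : U) (i : 'I_3) : U := nth x [:: x; y; z] i.

Lemma tripleE (x y z : U) :
  (triple x y z (inord 0) = x) * (triple x y z (inord 1) = y) *
  (triple x y z (inord 2) = z).
Proof. by rewrite /triple !inordK. Qed.

(** The value depends only on the largest final segment [{i, ..., 2}] contained in [C]. For
    [b2 <= b1] this is the least capacity with values [b1] on [{1, 2}] and [b2] on [{2}]. *)
Definition chain_capacity (b1 b2 : R) (C : {set 'I_3}) : R :=
  if inord 2 \in C then
    if inord 1 \in C then if inord 0 \in C then 1 else b1 else b2
  else 0.

Lemma chain_capacityP (b1 b2 : R) :
  0 <= b1 <= 1 -> 0 <= b2 <= 1 -> b2 <= b1 ->
  capacity (chain_capacity b1 b2).
Proof.
move=> /andP[b10 b11] /andP[b20 b21] b21'; rewrite /chain_capacity.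
split => [C|C D /fintype.subsetP CD||]; last 2 first.
- by rewrite !inE.
- by rewrite !inE.
- by do 3 ?case: ifP => _; rewrite ?lexx ?ler01 ?b10 ?b20.
(* The inclusion becomes three Boolean implications, so that a case split on the six memberships
   decides everything. *)
have {CD} := (introT implyP (CD (inord 0)), introT implyP (CD (inord 1)),
  introT implyP (CD (inord 2))).
case: (inord 0 \in C); case: (inord 1 \in C); case: (inord 2 \in C);
case: (inord 0 \in D); case: (inord 1 \in D); case: (inord 2 \in D);
  by case=> -[] //= *; rewrite ?lexx ?ler01 ?b21' ?b10 ?b11 ?b20 ?b21.
Qed.

Lemma chain_capacity_upper (b1 b2 : R) :
  (chain_capacity b1 b2 (upper 1%g 1) = b1) *
  (chain_capacity b1 b2 (upper 1%g 2) = b2).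
Proof.
have e i (k : 'I_3) : (k \in upper 1%g i) = (i <= k)%N.
  apply/imsetP/idP => [[j]|ik]; first by rewrite inE perm1 => ? ->.
  by exists k; rewrite ?inE ?perm1.
by rewrite /chain_capacity !e !inordK.
Qed.

End Triples.

(** The hypothesis makes the intersection of the two preorders on indices total; sorting the indices
    by this intersection sorts both families at once. *)
Lemma common_sorting (d : Order.disp_t) (U : porderType d) (le : rel U)
    (n : nat) (X Y : 'I_n -> U) :
  (forall i j, le (X i) (X j) && le (Y i) (Y j)
            || le (X j) (X i) && le (Y j) (Y i)) ->
  exists2 sigma : 'S_n, sorting le X sigma & sorting le Y sigma.
Proof.
move=> XY; pose r i j := le (X i) (X j) && le (Y i) (Y j).
have r_total : total r by [].
have r_sorted := sort_sorted r_total (enum 'I_n).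
have /tuple_permP[sigma] := permEl (perm_sort r (ord_tuple n)).
rewrite val_ord_tuple => es; exists sigma;
  have {}es : sort r (enum 'I_n) = [seq sigma i | i <- enum 'I_n] by
    rewrite es; apply: eq_map => i; rewrite tnth_ord_tuple.
all: rewrite /sorting map_comp -es sorted_map.
all: by apply: sub_sorted r_sorted => i j /andP[].
Qed.

(** * Clamping a threshold between two ordered families *)

Section Truncation.
Context {d : Order.disp_t} {U : porderType d}.
Variables (le : rel U) (le_adm : admissible le).
Variables (I : Type) (X Z : I -> U).
Hypothesis XZ : forall i, le (X i) (Z i).

Definition truncation (c : U) (i : I) : U :=
  if le (Z i) c then Z i else if le c (X i) then X i else c.

Lemma truncation_ge_all c : (forall i, le (Z i) c) -> truncation c =1 Z.
Proof. by move=> Zc i; rewrite /truncation Zc. Qed.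

Lemma truncation_le_all c : (forall i, le c (X i)) -> truncation c =1 X.
Proof.
case: le_adm => lexx leanti letrans _ _ cX i; rewrite /truncation cX.
case: ifP => // Zc; apply: leanti; rewrite XZ andbT.
exact: letrans Zc (cX i).
Qed.

Lemma le_truncation c c' i : le c c' -> le (truncation c i) (truncation c' i).
Proof.
case: le_adm => lexx leanti letrans letot _ cc'; rewrite /truncation.
case: (boolP (le (Z i) c)) => Zc; first by rewrite (letrans _ _ _ Zc cc').
have cZ : le c (Z i) by have := letot c (Z i); rewrite (negbTE Zc) orbF.
case: (boolP (le (Z i) c')) => Zc'; first by case: ifP.
case: (boolP (le c' (X i))) => c'X; first by rewrite (letrans _ _ _ cc' c'X).
have Xc' : le (X i) c' by have := letot (X i) c'; rewrite (negbTE c'X) orbF.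
by case: ifP.
Qed.

(** No endpoint of the interval from [X i] to [Z i] lies strictly between [c] and [c']. So the
    interval either contains both thresholds, which are then left unchanged, or lies on one side of
    the gap, and both are clamped to the same endpoint. *)
Lemma truncation_step c c' i : le c c' ->
  (forall v, v = X i \/ v = Z i -> le v c \/ le c' v) ->
  truncation c i = c /\ truncation c' i = c' \/
  truncation c i = truncation c' i /\
    (le (truncation c i) c \/ le c' (truncation c i)).
Proof.
case: le_adm => lexx leanti letrans letot _ cc' gap.
have eqle x y : le x y -> le y x -> x = y by move=> *; apply: leanti; apply/andP.
have := gap _ (or_introl erefl); have := gap _ (or_intror erefl).
rewrite /truncation.
case: (boolP (le (Z i) c)) => Zc.
  by rewrite (letrans _ _ _ Zc cc') => _ _; right; split => //; left.
case=> // c'Z.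
case: (boolP (le (Z i) c')) => Zc'.
  have -> : Z i = c' by apply: eqle.
  case: (boolP (le c (X i))) => cX.
    case=> [Xc|c'X]; first by left; split => //; apply: eqle.
    have -> : X i = c' by apply: eqle => //; apply: letrans (XZ i) _.
    by right; split => //; right.
  by left.
case: (boolP (le c (X i))) => cX.
  case=> [Xc|c'X]; last by rewrite c'X; right; split => //; right.
  left; split; first exact: eqle.
  by case: ifP => // c'X; apply: eqle => //; apply: letrans Xc cc'.
move=> _; left; split => //; case: ifP => // c'X.
by rewrite (letrans _ _ _ cc' c'X) in cX.
Qed.

(** Two moving indices share both values, two fixed ones compare the same way twice, and a fixed
    value, being below [c] or above [c'], is on the same side of a moving one before and after. *)
Lemma truncation_comonotone c c' : le c c' ->
  (forall i v, v = X i \/ v = Z i -> le v c \/ le c' v) ->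
  forall i j,
    le (truncation c i) (truncation c j)
      && le (truncation c' i) (truncation c' j)
    || le (truncation c j) (truncation c i)
      && le (truncation c' j) (truncation c' i).
Proof.
case: le_adm => lexx _ letrans letot _ cc' gap i j.
case: (truncation_step cc' (gap i)) => -[-> ei];
  case: (truncation_step cc' (gap j)) => -[-> ej].
- by rewrite ei ej !lexx.
- rewrite ei; case: ej => h; apply/orP; [right|left]; apply/andP; split => //.
  + exact: letrans h cc'.
  + exact: letrans cc' h.
- rewrite ej; case: ei => h; apply/orP; [left|right]; apply/andP; split => //.
  + exact: letrans h cc'.
  + exact: letrans cc' h.
- by rewrite !andbb.
Qed.

End Truncation.

(** * Reduction to pairs with a common sorting permutation *)

Section Monotonicity.
Context {R : realType} {d : Order.disp_t} {U : porderType d}.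
Variables (add : U -> U -> U) (le : rel U) (le_adm : admissible le).
Variables (K : set U) (zero : U) (zero_least : is_least K zero).
Variable L : U -> U -> R -> R -> U.

Lemma Cop_monotone_comonotone (n : nat) :
  Cop_well_defined add le K zero L n ->
  (forall X Z : 'I_n.+1 -> U,
     (forall i, K (X i)) -> (forall i, K (Z i)) ->
     (forall i, le (X i) (Z i)) ->
     forall (sigma : 'S_n.+1) (mu : {set 'I_n.+1} -> R),
       sorting le X sigma -> sorting le Z sigma -> capacity mu ->
       le (Cop add zero L sigma X mu) (Cop add zero L sigma Z mu)) ->
  Cop_monotone add le K zero L n.
Proof.
move=> wd comon X Z KX KZ XZ sigma tau mu sX sZ cmu.
case: (le_adm) => lexx leanti letrans letot lep.
have zle x : K x -> le zero x by move=> Kx; apply: lep; apply: zero_least.2.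
have eqC (Y Y' : 'I_n.+1 -> U) rho :
    Y =1 Y' -> Cop add zero L rho Y mu = Cop add zero L rho Y' mu.
  move=> YY'; have e i : previous zero Y rho i = previous zero Y' rho i.
    by case: i => //= i; rewrite YY'.
  by rewrite /Cop /bigadd YY' e; apply: eq_bigr => i _; rewrite YY' e.
have eqS (Y Y' : 'I_n.+1 -> U) rho :
    Y =1 Y' -> sorting le Y rho -> sorting le Y' rho.
  by move=> YY'; rewrite /sorting; under eq_map do rewrite YY'.
pose T := truncation le X Z.
have KT c i : K c -> K (T c i) by rewrite /T /truncation => ?; do 2?case: ifP.
(* Induction on the list [s] of thresholds still to come after [c]: every entry of [X] or [Z] is
   already below [c] or belongs to [s]. Once [s] is empty, the truncation is [Z]. *)
have chain s c rho : K c -> (forall v, v \in s -> K v) -> path le c s ->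
    (forall i v, v = X i \/ v = Z i -> le v c \/ v \in s) ->
    sorting le (T c) rho ->
    le (Cop add zero L rho (T c) mu) (Cop add zero L tau Z mu).
  elim: s c rho => [|c' s IHs] c rho Kc Ks cs val_s sT.
    have TZ : T c =1 Z.
      apply: truncation_ge_all => i.
      by case: (val_s i (Z i) (or_intror erefl)).
    rewrite (eqC _ _ _ TZ) (wd Z mu KZ cmu rho tau) //.
    exact: eqS TZ sT.
  move: cs => /= /andP[cc' c's].
  have Kc' : K c' by apply: Ks; rewrite mem_head.
  have c'_min v : v \in c' :: s -> le c' v.
    rewrite inE => /predU1P[->//|vs].
    exact: (allP (order_path_min letrans c's)).
  have gap i v : v = X i \/ v = Z i -> le v c \/ le c' v.
    by case/val_s; [left | move/c'_min; right].
  have [pi pT pT'] :=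
    common_sorting (truncation_comonotone le_adm XZ cc' gap).
  (* The given [rho] need not sort the next truncation, so it is exchanged for the common [pi]. *)
  rewrite (wd (T c) mu (fun i => KT c i Kc) cmu rho pi sT pT).
  apply: (letrans (Cop add zero L pi (T c') mu)).
    apply: comon => // i; try exact: KT.
    exact: le_truncation.
  apply: IHs => // [v vs|i v /val_s[vc|]].
  - by apply: Ks; rewrite inE vs orbT.
  - by left; apply: letrans vc cc'.
  - by rewrite inE => /predU1P[->|]; [left | right].
(* The chain starts at [zero], which lies below every entry and hence truncates to [X]. *)
pose s := sort le (codom X ++ codom Z).
have Ks v : v \in s -> K v.
  by rewrite mem_sort mem_cat => /orP[] /codomP[i ->].
have TX : T zero =1 X by apply: truncation_le_all => // i; apply: zle.
rewrite -(eqC _ _ _ TX); apply: (chain s) => //.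
- exact: zero_least.1.
- rewrite path_min_sorted; first exact: sort_sorted.
  by apply/allP => v /Ks; apply: zle.
- move=> i v h; right; rewrite mem_sort mem_cat.
  by case: h => ->; rewrite codom_f ?orbT.
- by apply: eqS sX => i; rewrite TX.
Qed.

End Monotonicity.

Section Cancellation.
Context {d : Order.disp_t} {U : porderType d}.
Variables (add : U -> U -> U) (le : rel U) (le_adm : admissible le).
Hypothesis add_compat : compatible le add.

(** Cancellation follows from totality: if [le x y] fails, then [y] is strictly below [x], and
    adding [v] keeps this strict, against antisymmetry. *)
Lemma compatible_le x y v : le (add x v) (add y v) = le x y.
Proof.
case: (le_adm) => lexx leanti letrans letot _.
have mono a b : le a b -> le (add a v) (add b v).
  move=> ab; have [->//|neq] := eqVneq a b.
  by have /andP[] := add_compat v (introT andP (conj ab neq)).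
apply/idP/idP; last exact: mono.
case: (boolP (le x y)) => // nxy xyv.
have yx : le y x by have := letot x y; rewrite (negbTE nxy).
have neq : y != x by apply: contraNneq nxy => ->; rewrite lexx.
have /andP[h1 /negP[]] := add_compat v (introT andP (conj yx neq)).
by apply/eqP; apply: leanti; rewrite h1.
Qed.

End Cancellation.

Theorem theorem3p7 (R : realType) (d : Order.disp_t) (U : porderType d)
  (add : U -> U -> U) (addA : associative add) (addC : commutative add)
  (le : rel U) (le_adm : admissible le)
  (K : set U) (zero one : U)
  (zero_least : is_least K zero) (one_greatest : is_greatest K one)
  (zero_neq_one : zero <> one)
  (L : U -> U -> R -> R -> U)
  (L_in_K : forall (x y : U) (a b : R), K x -> K y ->
     0 <= a <= 1 -> 0 <= b <= 1 -> K (L x y a b))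
  (add_compat : compatible le add) :
  Cop_monotone add le K zero L 2 <->
  [/\ Cop_well_defined add le K zero L 2,
      forall (v : U) (b1 b2 : R), K v ->
        0 <= b1 <= 1 -> 0 <= b2 <= 1 -> b2 <= b1 ->
        nondecreasing_in le (itvK K le zero v)
          (fun x => add (L x zero 1 b1) (L v x b1 b2)),
      forall (u v : U) (b1 b2 : R), K u -> K v -> le u v ->
        0 <= b1 <= 1 -> 0 <= b2 <= 1 -> b2 <= b1 ->
        nondecreasing_in le (itvK K le u v)
          (fun x => add (L x u b1 b2) (L v x b2 0)) &
      forall (u : U) (b : R), K u -> 0 <= b <= 1 ->
        nondecreasing_in le (itvK K le u one) (fun x => L x u b 0)].
Proof.
case: (le_adm) => lexx leanti letrans letot lep.
have [_ zmin] := zero_least; have [_ onemax] := one_greatest.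
have le0 x : K x -> le zero x by move=> /zmin; apply: lep.
have le1 x : K x -> le x one by move=> /onemax; apply: lep.
have le_add2r := compatible_le le_adm add_compat.
have le_add2l x y v : le (add v x) (add v y) = le x y.
  by rewrite ![add v _]addC le_add2r.
split=> [mono | [wd incr1 incr2 incr3]].
  (* Monotonicity for triples already in increasing order, where the identity sorts both and
     [chain_capacity] realises any [b2 <= b1]. *)
  have mono3 x1 x2 x3 z1 z2 z3 b1 b2 :
      K x1 -> K x2 -> K x3 -> K z1 -> K z2 -> K z3 ->
      le x1 x2 -> le x2 x3 -> le z1 z2 -> le z2 z3 ->
      le x1 z1 -> le x2 z2 -> le x3 z3 ->
      0 <= b1 <= 1 -> 0 <= b2 <= 1 -> b2 <= b1 ->
      le (add (L x1 zero 1 b1) (add (L x2 x1 b1 b2) (L x3 x2 b2 0)))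
         (add (L z1 zero 1 b1) (add (L z2 z1 b1 b2) (L z3 z2 b2 0))).
    move=> Kx1 Kx2 Kx3 Kz1 Kz2 Kz3 x12 x23 z12 z23 xz1 xz2 xz3 b1P b2P b21.
    have cmu := chain_capacityP b1P b2P b21.
    have := mono (triple x1 x2 x3) (triple z1 z2 z3) _ _ _ 1%g 1%g _ _ _ cmu.
    rewrite !Cop3 // !perm1 !tripleE !chain_capacity_upper; apply.
    - by apply: ord3P; rewrite tripleE.
    - by apply: ord3P; rewrite tripleE.
    - by apply: ord3P; rewrite !tripleE.
    - by apply/sorting3; rewrite !perm1 !tripleE.
    - by apply/sorting3; rewrite !perm1 !tripleE.
  split.
  (* Monotonicity from [X] to itself, used in both directions for two sortings, forces equality. *)
  - move=> X mu KX cmu sigma tau sX tX; apply: leanti.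
    by apply/andP; split; apply: mono.
  - move=> v b1 b2 Kv b1P b2P b21 x1 x2.
    rewrite !inE => -[Kx1 _ x1v] [Kx2 _ x2v] x12.
    (* The term added is the third one for the triple [(x, v, v)]. *)
    by rewrite -(le_add2r _ _ (L v v b2 0)) -!addA; apply: mono3.
  - move=> u v b1 b2 Ku Kv uv b1P b2P b21 x1 x2.
    rewrite !inE => -[Kx1 ux1 x1v] [Kx2 ux2 x2v] x12.
    by rewrite -(le_add2l _ _ (L u zero 1 b1)); apply: mono3.
  - move=> u b Ku bP x1 x2.
    rewrite !inE => -[Kx1 ux1 _] [Kx2 ux2 _] x12.
    (* The first two terms for [(u, u, x)] are restored, with [b1 = b2 = b]. *)
    rewrite -(le_add2l _ _ (L u u b b)) -(le_add2l _ _ (L u zero 1 b)).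
    exact: mono3.
apply: Cop_monotone_comonotone => // X Z KX KZ XZ sigma mu sX sZ cmu.
rewrite !Cop3 //; have [mu01 muS _ _] := cmu.
have b21 : mu (upper sigma 2) <= mu (upper sigma 1) by apply/muS/upperS.
move: (mu (upper sigma 1)) (mu01 (upper sigma 1)) b21 => b1 b1P.
move: (mu (upper sigma 2)) (mu01 (upper sigma 2)) => b2 b2P b21.
move/sorting3: sX; move/sorting3: sZ.
move: (KX (sigma (inord 0))) (KZ (sigma (inord 0))) (XZ (sigma (inord 0))).
move: (KX (sigma (inord 1))) (KZ (sigma (inord 1))) (XZ (sigma (inord 1))).
move: (KX (sigma (inord 2))) (KZ (sigma (inord 2))) (XZ (sigma (inord 2))).
move: (X (sigma _)) (Z (sigma _)) => x3 z3 Kx3 Kz3 xz3.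
move: (X (sigma _)) (Z (sigma _)) => x2 z2 Kx2 Kz2 xz2.
move: (X (sigma _)) (Z (sigma _)) => x1 z1 Kx1 Kz1 xz1.
move=> [z12 z23] [x12 x23].
(* Raising the largest entry first keeps the intermediate triples [(x1, x2, z3)] and [(x1, z2, z3)]
   sorted, so each moving entry stays in the interval its condition requires. *)
apply: (letrans (add (L x1 zero 1 b1) (add (L x2 x1 b1 b2) (L z3 x2 b2 0)))).
  rewrite !le_add2l; apply: incr3 => //; rewrite inE; split; auto.
  exact: letrans x23 xz3.
apply: (letrans (add (L x1 zero 1 b1) (add (L z2 x1 b1 b2) (L z3 z2 b2 0)))).
  have x1z2 := letrans _ _ _ x12 xz2.
  have x2z3 := letrans _ _ _ xz2 z23.
  rewrite le_add2l; apply: (incr2 x1 z3) => //.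
  - exact: letrans x1z2 z23.
  - by rewrite inE.
  - by rewrite inE.
rewrite !addA le_add2r; apply: (incr1 z2) => //; rewrite inE; split; auto.
exact: letrans x12 xz2.
Qed.
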